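(* The system $\mathbf{MI}$ is complete with respect to each of the following classes: (1) descriptive I-frames; (2) I-frames; (3) intuitionistic Kripke frames. That is, if a formula $\phi$ is valid on every frame in the class, then $\phi \in \mathbf{MI}$.
   Context: Formulas: $\phi ::= \top \mid p \mid \phi\wedge\phi \mid \phi \to \phi$ with $p$ from a set of proposition letters. $\mathbf{MI}$ is the set of formulas derivable (from no assumptions) using modus ponens from all substitution instances of the axioms (H1) $p\to(q\to p)$; (H2) $(p\to(q\to r))\to((p\to q)\to(p\to r))$; (H3) $(p\wedge q)\to p$; (H4) $(p\wedge q)\to q$; (H5) $p\to(q\to(p\wedge q))$; (H6) $\top$. An intuitionistic Kripke frame is a poset $(X,\leq)$; a model adds a valuation assigning an up-closed set to each letter; $\top$ always holds, $p$ holds at $x$ iff $x \in V(p)$, $\wedge$ is pointwise, and $x \Vdash \phi\to\psi$ iff every $y \geq x$ with $y\Vdash\phi$ satisfies $y \Vdash \psi$. An I-frame is a poset $(X,\leq)$ that is an implicative meet-semilattice with top (there is $\to$ with $x \leq y\to z$ iff $x\wedge y\leq z$); I-models are I-frames with valuations assigning to each letter a filter (non-empty up-closed subset closed under finite meets), with the same satisfaction clauses. For filters $a,b$ let $a\Rightarrow b=\{x\mid \forall y\geq x,\ y\in a \Rightarrow y\in b\}$. A descriptive I-frame is $(X,\leq,A)$ with $(X,\leq)$ an I-frame and $A$ a set of filters closed under $\cap$ and $\Rightarrow$, differentiated (if $x\not\leq y$ some $a\in A$ contains $x$ but not $y$), and compact (every cover of $X$ by members of $A$ and their complements has a finite subcover);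 its models use valuations with values in $A$. A formula is valid on a frame if it holds at every point of every model based on that frame (of the appropriate kind). *)

(* Defs.v *)
From mathcomp Require Import all_boot all_order.
From mathcomp Require Import boolp classical_sets functions cardinality.

Set Implicit Arguments.
Unset Strict Implicit.
Unset Printing Implicit Defensive.

Import Order.TTheory.

Local Open Scope order_scope.
Local Open Scope classical_set_scope.

Inductive formula (P : Type) : Type :=
| FTop
| FVar (p : P)
| FAnd (phi psi : formula P)
| FImp (phi psi : formula P).

Arguments FTop {P}.

Declare Scope formula_scope.
Delimit Scope formula_scope with F.
Bind Scope formula_scope with formula.
Infix "&&" := FAnd : formula_scope.
Infix "==>" := FImp : formula_scope.

Inductive MI (P : Type) : formula P -> Prop :=
| MI_H1 (p q : formula P) : MI (p ==> (q ==> p))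
| MI_H2 (p q r : formula P) :
    MI ((p ==> (q ==> r)) ==> ((p ==> q) ==> (p ==> r)))
| MI_H3 (p q : formula P) : MI ((p && q) ==> p)
| MI_H4 (p q : formula P) : MI ((p && q) ==> q)
| MI_H5 (p q : formula P) : MI (p ==> (q ==> (p && q)))
| MI_H6 : MI FTop
| MI_mp (p q : formula P) : MI (p ==> q) -> MI p -> MI q.

Section Posets.
Context {d : Order.disp_t} {X : porderType d}.

Definition upclosed (a : set X) : Prop := forall x y, x <= y -> a x -> a y.

Fixpoint sat (P : Type) (V : P -> set X) (x : X) (phi : formula P) : Prop :=
  match phi with
  | FTop => True
  | FVar p => V p x
  | FAnd phi psi => sat V x phi /\ sat V x psi
  | FImp phi psi => forall y, x <= y -> sat V y phi -> sat V y psi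
  end.

(* Validity with respect to the models whose valuation takes values in the
   family C of admissible sets: up-closed sets for Kripke frames, filters for
   I-frames, the designated filters for descriptive I-frames. *)
Definition valid_on (P : Type) (C : set (set X)) (phi : formula P) : Prop :=
  forall V : P -> set X, (forall p, C (V p)) -> forall x, sat V x phi.

Definition filter_imp (a b : set X) : set X :=
  [set x | forall y, x <= y -> a y -> b y].

Definition differentiated (A : set (set X)) : Prop :=
  forall x y : X, ~~ (x <= y) -> exists2 a, A a & a x /\ ~ a y.

Definition compact_family (A : set (set X)) : Prop :=
  forall C : set (set X),
    C `<=` A `|` [set ~` a | a in A] ->
    \bigcup_(c in C) c = [set: X] ->
    exists D : set (set X),
      [/\ D `<=` C, finite_set D & \bigcup_(c in D) c = [set: X]].

End Posets.

Section IFrames.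
Context {d : Order.disp_t} {X : tMeetSemilatticeType d}.

Definition meet_filter (a : set X) : Prop :=
  [/\ a !=set0, upclosed a & forall x y, a x -> a y -> a (x `&` y)%O].

Definition descriptive (A : set (set X)) : Prop :=
  [/\ A `<=` meet_filter,
      forall a b, A a -> A b -> A (a `&` b),
      forall a b, A a -> A b -> A (filter_imp a b),
      differentiated A
    & compact_family A].

End IFrames.

Definition implicative (d : Order.disp_t) (X : tMeetSemilatticeType d) : Prop :=
  exists imp : X -> X -> X,
    forall x y z : X, x <= imp y z <-> (x `&` y)%O <= z.

(* Main.v *)
(* The canonical model: its points are all the theories (sets of formulas that
   contain MI and are closed under modus ponens) ordered by inclusion, and each
   formula phi denotes the set of theories containing it. As there is no
   disjunction, theories need not be prime, so that they form a semilattice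
   under intersection, and {chi | phi ==> chi in T} is the theory that refutes
   psi above T whenever phi ==> psi is not in T. The denoted sets form a
   descriptive family, and MI itself is the least point, where exactly the
   derivable formulas hold. *)
From HB Require Import structures.
Require Import Defs.
From mathcomp Require Import all_boot all_order.
From mathcomp Require Import boolp classical_sets functions cardinality.

Import Order.TTheory.

Local Open Scope classical_set_scope.

Section Derivations.
Context {P : Type}.
Implicit Types phi psi chi : formula P.

Lemma MI_weaken phi psi : MI psi -> MI (phi ==> psi)%F.
Proof. exact: MI_mp (MI_H1 _ _). Qed.

Lemma MI_refl phi : MI (phi ==> phi)%F.
Proof.
apply: (MI_mp (p := (phi ==> (phi ==> phi))%F)); last exact: MI_H1.
by apply: (MI_mp (MI_H2 _ _ _)); apply: MI_H1.
Qed.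

Lemma MI_app phi psi : MI (phi ==> ((phi ==> psi) ==> psi))%F.
Proof.
have mp : MI (((phi ==> psi) ==> phi) ==> ((phi ==> psi) ==> psi))%F.
  exact: MI_mp (MI_H2 _ _ _) (MI_refl _).
(* Composition of [mp] with the instance [phi ==> ((phi ==> psi) ==> phi)] of H1. *)
exact: MI_mp (MI_mp (MI_H2 _ _ _) (MI_weaken phi _ mp)) (MI_H1 _ _).
Qed.

End Derivations.

Arguments MI_weaken {P} phi [psi] _.

Record theory (P : Type) := Theory {
  mem_theory :> formula P -> Prop;
  theory_MI : forall phi, MI phi -> mem_theory phi;
  theory_mp : forall phi psi,
    mem_theory (phi ==> psi)%F -> mem_theory phi -> mem_theory psi }.

Arguments Theory {P} _ _ _.
Arguments mem_theory {P} _ _.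
Arguments theory_MI {P} _ [phi] _.
Arguments theory_mp {P} _ [phi psi] _ _.

HB.instance Definition _ (P : Type) := gen_eqMixin (theory P).
HB.instance Definition _ (P : Type) := gen_choiceMixin (theory P).

Section TheoryOrder.
Context {P : Type}.
Implicit Types T U W : theory P.

Lemma theory_inj T U : mem_theory T = mem_theory U -> T = U.
Proof.
case: T U => [T T1 T2] [U U1 U2] /= TU; rewrite -TU in U1 U2 *.
by congr Theory; exact: Prop_irrelevance.
Qed.

Definition theory_le T U : bool := `[< mem_theory T `<=` mem_theory U >].

Lemma theory_le_refl : reflexive theory_le.
Proof. by move=> T; apply/asboolP. Qed.

Lemma theory_le_anti : antisymmetric theory_le.
Proof.
move=> T U /andP[/asboolP TU /asboolP UT].
by apply: theory_inj; apply/seteqP.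
Qed.

Lemma theory_le_trans : transitive theory_le.
Proof.
move=> U T W /asboolP TU /asboolP UW.
by apply/asboolP; apply: subset_trans UW.
Qed.

Definition theory_meet T U : theory P.
Proof.
apply: (Theory (mem_theory T `&` mem_theory U)) => [phi mi | phi psi [Ti Ui] [Tp Up]].
  by split; apply: theory_MI.
by split; [apply: theory_mp Ti Tp | apply: theory_mp Ui Up].
Defined.

Lemma theory_leI T U W :
  theory_le T (theory_meet U W) = theory_le T U && theory_le T W.
Proof.
by rewrite /theory_le -asbool_and; congr asbool; exact: subsetI.
Qed.

(** Without falsum there is no consistency condition on theories, so the set of all formulas counts
    as one; it also witnesses that each [theories_of phi] is non-empty. *)
Definition theory_top : theory P :=
  Theory setT (fun _ _ => I) (fun _ _ _ _ => I).

Lemma theory_le_top T : theory_le T theory_top.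
Proof. exact/asboolP. Qed.

End TheoryOrder.

Fact theory_display : Order.disp_t. Proof. exact: Order.Disp tt tt. Qed.

HB.instance Definition _ (P : Type) :=
  Order.Le_isPOrder.Build theory_display (theory P)
    theory_le_refl theory_le_anti theory_le_trans.
HB.instance Definition _ (P : Type) :=
  Order.POrder_isMeetSemilattice.Build theory_display (theory P) theory_leI.
HB.instance Definition _ (P : Type) :=
  Order.hasTop.Build theory_display (theory P) theory_le_top.

Section CanonicalFrame.
Context {P : Type}.
Implicit Types (phi psi chi : formula P) (T U W : theory P).

Lemma theory_leP {T U} : reflect (mem_theory T `<=` mem_theory U) (T <= U)%O.
Proof. exact: asboolP. Qed.

Definition MI_theory : theory P := Theory (@MI P) (fun _ => id) (@MI_mp P).

Definition theory_ext T phi : theory P.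
Proof.
apply: (Theory [set chi | T (phi ==> chi)%F]) => [chi mi | chi psi /= TH Tc].
  exact/theory_MI/MI_weaken.
by apply: theory_mp Tc; apply: theory_mp TH; exact/theory_MI/MI_H2.
Defined.

Lemma theory_le_ext T phi : (T <= theory_ext T phi)%O.
Proof.
by apply/theory_leP => chi /=; apply: theory_mp; exact/theory_MI/MI_H1.
Qed.

Lemma theory_ext_mem T phi : theory_ext T phi phi.
Proof. by rewrite /=; exact/theory_MI/MI_refl. Qed.

Definition theory_imp T U : theory P.
Proof.
apply: (Theory [set phi | forall psi, T psi -> MI (phi ==> psi)%F -> U psi]).
  by move=> phi mi psi _ H; apply: theory_MI; exact: MI_mp H mi.
move=> phi chi /= Uimp Uphi psi Tpsi chi_psi.
(* phi gives (phi ==> psi) ==> psi and phi ==> chi gives phi ==> psi; both of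
   these consequences belong to T because psi does. *)
have T_imp f : T (f ==> psi)%F.
  by apply: theory_mp Tpsi; exact/theory_MI/MI_H1.
have U1 : U (phi ==> psi)%F.
  apply: Uimp (T_imp phi) _.
  exact: MI_mp (MI_H2 _ _ _) (MI_weaken phi chi_psi).
by apply: theory_mp U1; apply: Uphi (T_imp _) (MI_app _ _).
Defined.

Lemma theory_implicative : implicative (theory P).
Proof.
exists theory_imp => T U W; split=> [/theory_leP TUW | /theory_leP TUW].
  by apply/theory_leP => phi [Tphi Uphi]; exact: TUW Uphi (MI_refl phi).
apply/theory_leP => phi Tphi psi Upsi imp.
by apply: TUW; split=> //; apply: theory_mp Tphi; exact: theory_MI.
Qed.

Definition theories_of phi : set (theory P) := [set T | T phi].

Lemma theories_of_and phi psi :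
  theories_of (phi && psi)%F = theories_of phi `&` theories_of psi.
Proof.
apply/seteqP; split=> T /= => [Tpp | [Tphi Tpsi]].
  by split; apply: theory_mp Tpp; apply: theory_MI;
    [exact: MI_H3 | exact: MI_H4].
by apply: theory_mp Tpsi; apply: theory_mp Tphi; exact/theory_MI/MI_H5.
Qed.

Lemma theories_of_imp phi psi :
  theories_of (phi ==> psi)%F =
  filter_imp (theories_of phi) (theories_of psi).
Proof.
apply/seteqP; split=> T /= => [Timp U /theory_leP TU | H].
  exact/theory_mp/TU.
(* Membership of [psi] in [theory_ext T phi] is by definition membership of [phi ==> psi] in [T]. *)
exact: H (theory_le_ext T phi) (theory_ext_mem T phi).
Qed.

Lemma theories_of_upclosed phi : upclosed (theories_of phi).
Proof. by move=> T U /theory_leP; apply. Qed.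

Lemma theories_of_filter phi : meet_filter (theories_of phi).
Proof.
by split; [exists \top%O | exact: theories_of_upclosed | move=> T U].
Qed.

(** The truth lemma. The induction treats all theories at once because the clause for implication
    passes to larger ones. *)
Lemma sat_canonical T phi :
  sat (fun p => theories_of (FVar p)) T phi <-> T phi.
Proof.
elim: phi T => [|p|phi IHphi psi IHpsi|phi IHphi psi IHpsi] T //=.
- by split=> // _; exact/theory_MI/MI_H6.
- rewrite IHphi IHpsi -[T (phi && psi)%F]/(theories_of (phi && psi)%F T).
  by rewrite theories_of_and.
- rewrite -[T (phi ==> psi)%F]/(theories_of (phi ==> psi)%F T).
  rewrite theories_of_imp.
  split=> H U TU.
    by move=> Uphi; apply/IHpsi/(H U TU)/IHphi.
  by move=> /IHphi Uphi; apply/IHpsi/(H U TU).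
Qed.

Inductive derivable (G : set (formula P)) : formula P -> Prop :=
| derivable_hyp phi of G phi : derivable G phi
| derivable_MI phi of MI phi : derivable G phi
| derivable_mp phi psi of derivable G (phi ==> psi)%F & derivable G phi :
    derivable G psi.

Definition generated_theory (G : set (formula P)) : theory P :=
  Theory (derivable G) (derivable_MI G) (derivable_mp G).

(** A derivation uses finitely many hypotheses, and [D] collects the complements attached to them. A
    theory omitting the conclusion of a modus ponens omits one of its premises, hence, going up the
    derivation, some hypothesis. *)
Lemma derivable_finite_cover (C : set (set (theory P))) phi :
  derivable [set psi | C (~` theories_of psi)] phi ->
  exists D, [/\ D `<=` C, finite_set D
    & forall T, ~ T phi -> (\bigcup_(c in D) c) T].
Proof.
elim=> [{}phi Cphi | {}phi mi | {}phi psi _ [D [DC Dfin DT]] _ [E [EC Efin ET]]].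
- exists [set ~` theories_of phi]; split=> [_ ->//||T nT].
    exact: finite_set1.
  by exists (~` theories_of phi).
- by exists set0; split=> // T []; exact: theory_MI.
- exists (D `|` E); split=> [c [/DC|/EC]//||T nT].
    by rewrite finite_setU.
  rewrite bigcup_setU.
  have [Tphi | /ET] := pselect (T phi); last by right.
  by left; apply: DT => Timp; apply: nT; exact: theory_mp Timp Tphi.
Qed.

(** Let [G] consist of the formulas whose complements occur in the cover. The theory generated by
    [G] avoids all these complements, so some [theories_of phi] in the cover contains it. Then [phi]
    is derivable from [G], and finitely many complements cover the theories that omit [phi]. *)
Lemma theories_of_compact : compact_family (range theories_of).
Proof.
move=> C CA Ccover.
pose G := [set psi | C (~` theories_of psi)].
have : (\bigcup_(c in C) c) (generated_theory G) by rewrite Ccover.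
case=> c Cc cG; case: (CA c Cc) => [[phi _ cE] | [_ [psi _ <-] cE]]; last first.
  by rewrite -cE in cG Cc; case: cG; exact: derivable_hyp.
rewrite -cE in cG Cc.
have [D [DC Dfin DT]] := derivable_finite_cover C phi cG.
exists (theories_of phi |` D); split=> [_ [->//|/DC//]||].
  rewrite finite_setU; split=> //; exact: finite_set1.
rewrite bigcup_setU1; apply/seteqP; split=> // T _.
by have [Tphi | /DT] := pselect (T phi); [left | right].
Qed.

Lemma theories_of_descriptive : descriptive (range theories_of).
Proof.
split.
- by move=> _ [phi _ <-]; exact: theories_of_filter.
- move=> _ _ [phi _ <-] [psi _ <-].
  by exists (phi && psi)%F => //; exact: theories_of_and.
- move=> _ _ [phi _ <-] [psi _ <-].
  by exists (phi ==> psi)%F => //; exact: theories_of_imp.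
- move=> T U /theory_leP /existsNP[phi /not_implyP[Tphi nUphi]].
  by exists (theories_of phi) => //; exists phi.
- exact: theories_of_compact.
Qed.

(** One valuation serves all three frame classes: only the family [C] of admissible sets changes,
    and it has to contain the sets [theories_of psi]. *)
Lemma canonical_complete (C : set (set (theory P))) phi :
  range theories_of `<=` C -> valid_on C phi -> MI phi.
Proof.
move=> sub valid; apply/(sat_canonical MI_theory).
by apply: valid => p; apply: sub; exists (FVar p).
Qed.

End CanonicalFrame.

Theorem theorem3p12 (P : Type) :
  [/\ (forall phi : formula P,
         (forall (d : Order.disp_t) (X : tMeetSemilatticeType d)
                 (A : set (set X)),
            implicative X -> descriptive A -> valid_on A phi) ->
         MI phi),
      (forall phi : formula P,
         (forall (d : Order.disp_t) (X : tMeetSemilatticeType d),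
            implicative X -> valid_on (@meet_filter d X) phi) ->
         MI phi)
    & (forall phi : formula P,
         (forall (d : Order.disp_t) (X : porderType d),
            valid_on (@upclosed d X) phi) ->
         MI phi)].
Proof.
split=> phi valid.
- apply: (canonical_complete (range theories_of)) => //.
  by apply: valid; [exact: theory_implicative | exact: theories_of_descriptive].
- apply: (canonical_complete (@meet_filter _ (theory P))).
    by move=> _ [psi _ <-]; exact: theories_of_filter.
  by apply: valid; exact: theory_implicative.
- apply: (canonical_complete (@upclosed _ (theory P))); last exact: valid.
  by move=> _ [psi _ <-]; exact: theories_of_upclosed.
Qed.
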